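(* Let $\mathcal{A}\subseteq\mathbb{R}^3$, $K\ge2$, $P_1,\ldots,P_K>0$, $\sigma^2>0$, and $h_1,\ldots,h_K\in L^2(\mathcal{A})$ with positive definite Gram matrix $\mathbf{R}$, $r_{k_1,k_2}=[\mathbf{R}]_{k_1,k_2}=\int_{\mathcal{A}}h_{k_1}^{*}h_{k_2}\,\mathrm{d}\mathbf{r}$. For a nonzero $w_k\in L^2(\mathcal{A})$ define the SINR $$\gamma_k(w_k)=\frac{\frac{P_k}{\sigma^2}\left|\int_{\mathcal{A}}w_k^{*}h_k\,\mathrm{d}\mathbf{r}\right|^2}{\sum_{k'\neq k}\frac{P_{k'}}{\sigma^2}\left|\int_{\mathcal{A}}w_k^{*}h_{k'}\,\mathrm{d}\mathbf{r}\right|^2+\int_{\mathcal{A}}|w_k|^2\,\mathrm{d}\mathbf{r}}$$ and the rate $\mathcal{R}_k=\log_2(1+\gamma_k)$. Fix $k$, let $\mathbf{h}_{\setminus k}(\mathbf{r})=[h_{k'}(\mathbf{r})]_{k'\neq k}\in\mathbb{C}^{1\times(K-1)}$, $\mathbf{R}_k$ the matrix $\mathbf{R}$ with row and column $k$ removed, $\mathbf{r}_{k,k}=[r_{k',k}]_{k'\neq k}\in\mathbb{C}^{(K-1)\times1}$, $\mathbf{P}_k=\mathrm{diag}(P_{k'}/\sigma^2)_{k'\neq k}$, $\mathbf{C}_k=\mathbf{P}_k^{1/2}\mathbf{R}_k\mathbf{P}_k^{1/2}$, and $\overline{\mathbf{C}}_k=(\mathbf{I}_{K-1}+\mathbf{C}_k)^{-1}$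 with entries $\overline{c}_{k_1,k_2}$ ($k_1,k_2\neq k$). Then the beamformer $$w_{\mathsf{MMSE},k}(\mathbf{r})=h_k(\mathbf{r})-\sum_{k_1\neq k}\sum_{k_2\neq k}\overline{c}_{k_1,k_2}\frac{\sqrt{P_{k_1}P_{k_2}}}{\sigma^2}h_{k_1}(\mathbf{r})r_{k_2,k}=h_k(\mathbf{r})-\mathbf{h}_{\setminus k}(\mathbf{r})(\mathbf{P}_k^{-1}+\mathbf{R}_k)^{-1}\mathbf{r}_{k,k}$$ maximizes $\gamma_k(w_k)$ (equivalently the per-user rate $\mathcal{R}_k$) over all nonzero $w_k\in L^2(\mathcal{A})$.
   Context: Standing assumption: channel responses pairwise non-parallel and $\mathbf{R}$ positive definite. *)

(* Defs.v *)
(* MathComp + MathComp-Analysis (+ real_closed's complex numbers R[i]). *)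
From HB Require Import structures.
From mathcomp Require Import all_boot all_order all_algebra.
From mathcomp Require Import all_classical all_reals all_analysis.
From mathcomp Require Import complex.
Set Implicit Arguments.
Unset Strict Implicit.
Unset Printing Implicit Defensive.
Import Order.TTheory GRing.Theory Num.Theory.
Local Open Scope ring_scope.
Local Open Scope complex_scope.

(* Points r of R^3, represented as ((x, y), z). *)
Definition R3 (R : realType) : Type := (R * R * R)%type.

(* Lebesgue measure on R^3 (product of three Lebesgue measures on R). *)
Definition leb3 (R : realType) :=
  ((@lebesgue_measure R \x @lebesgue_measure R) \x @lebesgue_measure R)%E.

Section Defs.
Variable R : realType.
Variable A : set (R3 R).

(* |z|^2 for a complex number z *)
Definition cabs2 (z : R[i]) : R := (complex.Re z) ^+ 2 + (complex.Im z) ^+ 2.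

(* f : A -> C is (a representative of) an element of L^2(A) *)
Definition L2 (f : R3 R -> R[i]) : Prop :=
  [/\ measurable_fun A (fun x => complex.Re (f x)),
      measurable_fun A (fun x => complex.Im (f x)) &
      (@leb3 R).-integrable A (fun x => (cabs2 (f x))%:E)].

(* complex-valued Lebesgue integral over A *)
Definition cint (f : R3 R -> R[i]) : R[i] :=
  (Rintegral (@leb3 R) A (fun x => complex.Re (f x))) +i*
  (Rintegral (@leb3 R) A (fun x => complex.Im (f x))).

(* L^2 inner product  <f, g> = \int_A f^* g dr *)
Definition ip (f g : R3 R -> R[i]) : R[i] := cint (fun x => (f x)^* * g x).

(* \int_A |f|^2 dr *)
Definition sqnorm (f : R3 R -> R[i]) : R :=
  Rintegral (@leb3 R) A (fun x => cabs2 (f x)).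

Variable K : nat.
Variable P : 'I_K -> R.      (* transmit powers P_1..P_K *)
Variable s2 : R.             (* noise variance sigma^2 *)
Variable h : 'I_K -> R3 R -> R[i].  (* channel responses *)

(* Gram matrix R, r_{k1,k2} = \int_A h_{k1}^* h_{k2} dr *)
Definition gram : 'M[R[i]]_K := \matrix_(i, j) ip (h i) (h j).

(* SINR of user k with beamformer w *)
Definition sinr (k : 'I_K) (w : R3 R -> R[i]) : R :=
  (P k / s2 * cabs2 (ip w (h k))) /
  (\sum_(k' < K | k' != k) P k' / s2 * cabs2 (ip w (h k')) + sqnorm w).

(* rate log2(1 + gamma) *)
Definition rate (k : 'I_K) (w : R3 R -> R[i]) : R :=
  ln (1 + sinr k w) / ln 2.

Variable k : 'I_K.

(* R_k : R with row and column k removed *)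
Definition Rk : 'M[R[i]]_K.-1 := \matrix_(i, j) gram (lift k i) (lift k j).

(* C_k = P_k^{1/2} R_k P_k^{1/2}, P_k = diag(P_{k'}/sigma^2)_{k' != k} *)
Definition Ck : 'M[R[i]]_K.-1 :=
  \matrix_(i, j) ((Num.sqrt (P (lift k i) / s2))%:C * Rk i j
                  * (Num.sqrt (P (lift k j) / s2))%:C).

(* \bar C_k = (I + C_k)^{-1} *)
Definition Cbar : 'M[R[i]]_K.-1 := invmx (1%:M + Ck).

(* MMSE beamformer, first (entrywise) formula *)
Definition wMMSE : R3 R -> R[i] := fun x =>
  h k x - \sum_(i < K.-1) \sum_(j < K.-1)
            Cbar i j * (Num.sqrt (P (lift k i) * P (lift k j)) / s2)%:C
            * h (lift k i) x * gram (lift k j) k.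

(* MMSE beamformer, matrix formula h_k - h_{\k} (P_k^{-1} + R_k)^{-1} r_{k,k} *)
Definition wMMSE_mx : R3 R -> R[i] := fun x =>
  h k x - ((\row_(i < K.-1) h (lift k i) x)
            *m invmx (diag_mx (\row_(i < K.-1) (s2 / P (lift k i))%:C) + Rk)
            *m (\col_(i < K.-1) gram (lift k i) k)) 0 0.

End Defs.

(* Hermitian positive definiteness of a complex square matrix *)
Definition posdef (R : realType) (n : nat) (M : 'M[R[i]]_n) : Prop :=
  forall v : 'cV[R[i]]_n, v != 0 ->
    0 < ((map_mx (fun z => z^*) v)^T *m M *m v) 0 0.

(* Main.v *)
(* With p_i = P_i / sigma^2, the denominator of the SINR is B(w, w) for the
   positive hermitian form
     B(f, g) = sum_(i <> k) p_i <f, h_i> <h_i, g> + <f, g>.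
   The MMSE beamformer represents <., h_k> for B, that is,
   B(f, w_MMSE) = <f, h_k>, so Cauchy-Schwarz for B bounds the SINR by
   p_k B(w_MMSE, w_MMSE), which is its value at w_MMSE.  The two formulas for
   w_MMSE agree because I + C_k = P_k^(1/2) (P_k^-1 + R_k) P_k^(1/2). *)
Require Import Defs.
From HB Require Import structures.
From mathcomp Require Import all_boot all_order all_algebra.
From mathcomp Require Import all_classical all_reals all_analysis.
From mathcomp Require Import measurable_realfun complex ring lra.
Import Order.TTheory GRing.Theory Num.Theory.
Local Open Scope ring_scope.
Set Implicit Arguments.
Unset Strict Implicit.
Unset Printing Implicit Defensive.

(** Gives the constant [leb3] the measure structure of the product it unfolds to, so that the
    integration lemmas apply to it. *)
HB.instance Definition _ (R : realType) := Measure.copy (@leb3 R)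
  ((@lebesgue_measure R \x @lebesgue_measure R) \x @lebesgue_measure R)%E.

(** * Real and imaginary parts *)

Section ComplexParts.
Context (R : rcfType).
Implicit Types z w : R[i].

Lemma ReD z w : complex.Re (z + w) = complex.Re z + complex.Re w.
Proof. by case: z w => [? ?] [? ?]. Qed.

Lemma ImD z w : complex.Im (z + w) = complex.Im z + complex.Im w.
Proof. by case: z w => [? ?] [? ?]. Qed.

Lemma ReM z w : complex.Re (z * w) =
  complex.Re z * complex.Re w - complex.Im z * complex.Im w.
Proof. by case: z w => [? ?] [? ?]. Qed.

Lemma ImM z w : complex.Im (z * w) =
  complex.Re z * complex.Im w + complex.Im z * complex.Re w.
Proof. by case: z w => [? ?] [? ?]. Qed.

Lemma Re_conj z : complex.Re z^* = complex.Re z.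
Proof. by case: z. Qed.

Lemma Im_conj z : complex.Im z^* = - complex.Im z.
Proof. by case: z. Qed.
End ComplexParts.

(** * The squared modulus and pointwise bounds *)

Section SquaredModulus.
Context (R : realType).
Implicit Types z w : R[i].

Lemma cabs2_ge0 z : 0 <= cabs2 z.
Proof. by rewrite addr_ge0 ?sqr_ge0. Qed.

Lemma cabs2E z : (cabs2 z)%:C%C = z^* * z.
Proof.
apply/eqP; rewrite eq_complex ReM ImM Re_conj Im_conj /cabs2 /=.
by apply/andP; split; apply/eqP; ring.
Qed.

Lemma cabs2_gt0 z : z != 0 -> 0 < cabs2 z.
Proof. by move=> z0; rewrite -ltcR cabs2E mulrC -normCK exprn_gt0 ?normr_gt0. Qed.

Lemma cabs2M z w : cabs2 (z * w) = cabs2 z * cabs2 w.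
Proof. by rewrite /cabs2 ReM ImM; ring. Qed.

(** Parallelogram law: the difference of the two sides is |z - w|^2. *)
Lemma cabs2D_le z w : cabs2 (z + w) <= 2 * cabs2 z + 2 * cabs2 w.
Proof.
rewrite /cabs2 ReD ImD -subr_ge0.
set a := complex.Re z; set b := complex.Im z.
set c := complex.Re w; set d := complex.Im w.
rewrite [X in 0 <= X](_ : _ = (a - c) ^+ 2 + (b - d) ^+ 2); last by ring.
by rewrite addr_ge0 ?sqr_ge0.
Qed.

(** Serves only to dominate f^* g by an integrable function, so the sharp factor 1/2 is dropped. *)
Lemma Re_conjM_le z w : `|complex.Re (z^* * w)| <= cabs2 z + cabs2 w.
Proof.
rewrite ReM Re_conj Im_conj /cabs2.
set a := complex.Re z; set b := complex.Im z.
set c := complex.Re w; set d := complex.Im w.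
have := (sqr_ge0 a, sqr_ge0 b, sqr_ge0 c, sqr_ge0 d).
have := (sqr_ge0 (a + c), sqr_ge0 (a - c), sqr_ge0 (b + d), sqr_ge0 (b - d)).
by move=> [[[? ?] ?] ?] [[[? ?] ?] ?]; rewrite ler_norml; apply/andP; split; nra.
Qed.

Lemma Im_conjM_le z w : `|complex.Im (z^* * w)| <= cabs2 z + cabs2 w.
Proof.
rewrite ImM Re_conj Im_conj /cabs2.
set a := complex.Re z; set b := complex.Im z.
(* Naming the parts of [w] in this order makes the products [a * c] and [b * d] again, so the same
   squares serve. *)
set c := complex.Im w; set d := complex.Re w.
have := (sqr_ge0 a, sqr_ge0 b, sqr_ge0 c, sqr_ge0 d).
have := (sqr_ge0 (a + c), sqr_ge0 (a - c), sqr_ge0 (b + d), sqr_ge0 (b - d)).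
by move=> [[[? ?] ?] ?] [[[? ?] ?] ?]; rewrite ler_norml; apply/andP; split; nra.
Qed.
End SquaredModulus.

(* [leb3] lives on [measurableTypeR], whose measurable structure is convertible
   but not syntactically equal to the canonical one of [R * R * R]. *)
Local Notation leb3_space R :=
  (measurableTypeR R * measurableTypeR R * measurableTypeR R)%type.

(** * L^2(A): closure properties, complex integral, inner product *)

Section ComplexL2.
Context (R : realType) (A : set (R3 R)).
Hypothesis mA : measurable (A : set (leb3_space R)).
Implicit Types (f g : R3 R -> R[i]) (c : R[i]).

Definition cintegrable f :=
  (@leb3 R).-integrable A (EFin \o (fun x => complex.Re (f x))) /\
  (@leb3 R).-integrable A (EFin \o (fun x => complex.Im (f x))).

Lemma cintD f g : cintegrable f -> cintegrable g ->
  cint A (fun x => f x + g x) = cint A f + cint A g.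
Proof.
move=> [fR fI] [gR gI]; rewrite /cint.
under eq_Rintegral do rewrite ReD.
under [in X in Complex _ X]eq_Rintegral do rewrite ImD.
by rewrite !RintegralD.
Qed.

Lemma cintZ c f : cintegrable f -> cint A (fun x => c * f x) = c * cint A f.
Proof.
case: c => a b [fR fI]; rewrite /cint.
under eq_Rintegral do rewrite ReM/=.
under [in X in Complex _ X]eq_Rintegral do rewrite ImM/=.
rewrite RintegralB //; last 2 first.
  exact: (integrableZl mA a fR).
  exact: (integrableZl mA b fI).
rewrite RintegralD //; last 2 first.
  exact: (integrableZl mA a fI).
  exact: (integrableZl mA b fR).
by rewrite !RintegralZl.
Qed.


(* Restates the measurability conditions over [leb3_space], by conversion. *)
Lemma L2P f : L2 A f <->
  [/\ measurable_fun (A : set (leb3_space R)) (fun x => complex.Re (f x)),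
      measurable_fun (A : set (leb3_space R)) (fun x => complex.Im (f x)) &
      (@leb3 R).-integrable A (EFin \o (fun x => cabs2 (f x)))].
Proof. by []. Qed.

(** Comparison test that reduces closure of L^2 to pointwise bounds on the squared modulus. *)
Lemma L2_dominated f (G : R3 R -> R) :
  measurable_fun (A : set (leb3_space R)) (fun x => complex.Re (f x)) ->
  measurable_fun (A : set (leb3_space R)) (fun x => complex.Im (f x)) ->
  (@leb3 R).-integrable A (EFin \o G) ->
  (forall x, cabs2 (f x) <= G x) -> L2 A f.
Proof.
move=> mR mI iG fG; apply/L2P; split=> //.
apply: (le_integrable mA _ _ iG).
  by apply/measurable_EFinP/measurable_funD; apply: measurable_funX.
move=> x _ /=; rewrite lee_fin ger0_norm ?cabs2_ge0//.
exact: le_trans (fG x) (ler_norm _).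
Qed.

Lemma L20 : L2 A (fun=> 0).
Proof.
apply: (@L2_dominated _ (fun=> 0)).
- exact: measurable_cst.
- exact: measurable_cst.
- exact: integrable0.
- by move=> x; rewrite /cabs2 /= expr0n addr0.
Qed.

Lemma L2D f g : L2 A f -> L2 A g -> L2 A (fun x => f x + g x).
Proof.
move=> /L2P[fR fI f2] /L2P[gR gI g2].
apply: (@L2_dominated _ (fun x => 2 * cabs2 (f x) + 2 * cabs2 (g x))).
- under eq_fun do rewrite ReD; exact: measurable_funD.
- under eq_fun do rewrite ImD; exact: measurable_funD.
- exact: (integrableD mA (integrableZl mA 2 f2) (integrableZl mA 2 g2)).
- by move=> x; exact: cabs2D_le.
Qed.

Lemma L2Z c f : L2 A f -> L2 A (fun x => c * f x).
Proof.
move=> /L2P[fR fI f2].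
have mZ a (u : R3 R -> R) : measurable_fun (A : set (leb3_space R)) u ->
    measurable_fun (A : set (leb3_space R)) (fun x => a * u x).
  by move=> mu; apply: measurable_funM => //; exact: measurable_cst.
apply: (@L2_dominated _ (fun x => cabs2 c * cabs2 (f x))).
- under eq_fun do rewrite ReM; apply: measurable_funB; exact: mZ.
- under eq_fun do rewrite ImM; apply: measurable_funD; exact: mZ.
- exact: (integrableZl mA (cabs2 c) f2).
- by move=> x; rewrite cabs2M.
Qed.

Lemma L2_sum (I : Type) (s : seq I) (F : I -> R3 R -> R[i]) :
  (forall i, L2 A (F i)) -> L2 A (fun x => \sum_(i <- s) F i x).
Proof.
move=> LF; elim: s => [|i s IHs].
  by under eq_fun do rewrite big_nil; exact: L20.
by under eq_fun do rewrite big_cons; exact: L2D.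
Qed.

(** Both parts of f^* g are dominated by the integrable function |f|^2 + |g|^2. *)
Lemma L2_conjM f g : L2 A f -> L2 A g -> cintegrable (fun x => (f x)^* * g x).
Proof.
move=> /L2P[fR fI f2] /L2P[gR gI g2].
have fg := integrableD mA f2 g2.
split; apply: (le_integrable mA _ _ fg).
- apply/measurable_EFinP; under eq_fun do rewrite ReM Re_conj Im_conj.
  apply: measurable_funB; apply: measurable_funM => //.
  exact: measurable_funN.
- move=> x _ /=; rewrite lee_fin.
  rewrite [leRHS]ger0_norm; last exact: addr_ge0 (cabs2_ge0 _) (cabs2_ge0 _).
  exact: Re_conjM_le.
- apply/measurable_EFinP; under eq_fun do rewrite ImM Re_conj Im_conj.
  apply: measurable_funD; apply: measurable_funM => //.
  exact: measurable_funN.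
- move=> x _ /=; rewrite lee_fin.
  rewrite [leRHS]ger0_norm; last exact: addr_ge0 (cabs2_ge0 _) (cabs2_ge0 _).
  exact: Im_conjM_le.
Qed.

Lemma ipDr f g g' : L2 A f -> L2 A g -> L2 A g' ->
  ip A f (fun x => g x + g' x) = ip A f g + ip A f g'.
Proof.
move=> Lf Lg Lg'; rewrite /ip -cintD; [|exact: L2_conjM..].
by congr cint; apply/funext => x; rewrite mulrDr.
Qed.

Lemma ipZr c f g : L2 A f -> L2 A g -> ip A f (fun x => c * g x) = c * ip A f g.
Proof.
move=> Lf Lg; rewrite /ip -cintZ; last exact: L2_conjM.
by congr cint; apply/funext => x; rewrite mulrCA.
Qed.

Lemma ipC f g : L2 A f -> L2 A g -> (ip A f g)^* = ip A g f.
Proof.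
move=> Lf Lg; have [_ igf] := L2_conjM Lg Lf.
apply/eqP; rewrite eq_complex Re_conj Im_conj; apply/andP; split; apply/eqP.
  by apply: eq_Rintegral => x _; rewrite !ReM !Re_conj !Im_conj; ring.
rewrite /ip /cint /= -mulN1r -RintegralZl //; last first.
  by case: (L2_conjM Lf Lg).
by apply: eq_Rintegral => x _; rewrite !ImM !Re_conj !Im_conj; ring.
Qed.

Lemma ip_sqnorm f : ip A f f = (sqnorm A f)%:C%C.
Proof.
rewrite /ip /cint /sqnorm /real_complex_def.
under eq_Rintegral do rewrite -cabs2E /=.
under [in X in Complex _ X]eq_Rintegral do rewrite -cabs2E /=.
by rewrite /Rintegral integral0.
Qed.

Lemma sqnorm_ge0 f : 0 <= sqnorm A f.
Proof. by apply: Rintegral_ge0 => x _; exact: cabs2_ge0. Qed.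

Lemma ip_sumr (I : Type) (s : seq I) f (F : I -> R3 R -> R[i]) :
  L2 A f -> (forall i, L2 A (F i)) ->
  ip A f (fun x => \sum_(i <- s) F i x) = \sum_(i <- s) ip A f (F i).
Proof.
move=> Lf LF; elim: s => [|i s IHs].
  rewrite big_nil.
  (* The empty sum is read as the scalar 0 times the zero function, so homogeneity evaluates it. *)
  under eq_fun do rewrite big_nil -(mul0r 0).
  by rewrite (ipZr 0) ?mul0r //; exact: L20.
rewrite big_cons -IHs -ipDr //; last exact: L2_sum.
by congr ip; apply/funext => x; rewrite big_cons.
Qed.

End ComplexL2.

(** Passes from sums over i <> k to the index set of the reduced matrices; adding [F k] turns both
    sides into the full sum. *)
Lemma sum_lift (V : zmodType) (n : nat) (k : 'I_n) (F : 'I_n -> V) :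
  \sum_(i < n | i != k) F i = \sum_(j < n.-1) F (lift k j).
Proof.
by apply: (addrI (F k)); rewrite -(bigD1_ord k (P := predT))// [RHS](bigD1 k).
Qed.

(** * Gram matrices and linear combinations *)

Section GramMatrix.
Context (R : realType) (A : set (R3 R)) (n : nat) (g : 'I_n -> R3 R -> R[i]).
Hypothesis mA : measurable (A : set (leb3_space R)).
Hypothesis Lg : forall i, L2 A (g i).

Definition lincomb (v : 'I_n -> R[i]) : R3 R -> R[i] :=
  fun x => \sum_i v i * g i x.

Lemma L2_lincomb v : L2 A (lincomb v).
Proof. by apply: L2_sum => // i; exact: L2Z. Qed.

Lemma ip_lincomb f v : L2 A f -> ip A f (lincomb v) = \sum_i v i * ip A f (g i).
Proof.
move=> Lf; rewrite ip_sumr//; last by move=> i; exact: L2Z.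
by apply: eq_bigr => i _; rewrite ipZr.
Qed.

(** Expand <f, f> for the combination f. This gives semidefiniteness of any Gram matrix, and
    positive norm of nontrivial combinations when the matrix is positive definite. *)
Lemma gram_quad (v : 'cV[R[i]]_n) :
  ((map_mx (fun z => z^*) v)^T *m gram A g *m v) 0 0 =
  (sqnorm A (lincomb (fun i => v i 0)))%:C%C.
Proof.
rewrite -ip_sqnorm// ip_lincomb; last exact: L2_lincomb.
rewrite mxE; apply: eq_bigr => i _; rewrite mulrC; congr (_ * _).
rewrite -ipC//; last exact: L2_lincomb.
rewrite ip_lincomb// rmorph_sum mxE; apply: eq_bigr => j _.
by rewrite !mxE rmorphM /= ipC.
Qed.

End GramMatrix.

(** * The hermitian form B and its Cauchy-Schwarz inequality *)

Section RegularizedForm.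
Context (R : realType) (A : set (R3 R)) (K : nat) (k : 'I_K).
Context (p : 'I_K -> R) (h : 'I_K -> R3 R -> R[i]).
Hypothesis mA : measurable (A : set (leb3_space R)).
Hypothesis p_ge0 : forall i, 0 <= p i.
Hypothesis Lh : forall i, L2 A (h i).
Implicit Types f g w : R3 R -> R[i].

Definition reg_form f g : R[i] :=
  \sum_(i < K | i != k) (p i)%:C%C * (ip A f (h i) * ip A (h i) g) + ip A f g.

Definition reg_power f : R :=
  \sum_(i < K | i != k) p i * cabs2 (ip A f (h i)) + sqnorm A f.

Lemma reg_power_ge0 f : 0 <= reg_power f.
Proof.
apply: addr_ge0; last exact: sqnorm_ge0.
by apply: sumr_ge0 => i _; apply: mulr_ge0; [exact: p_ge0|exact: cabs2_ge0].
Qed.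

Lemma reg_formE f : L2 A f -> reg_form f f = (reg_power f)%:C%C.
Proof.
move=> Lf; rewrite /reg_form /reg_power rmorphD rmorph_sum /= ip_sqnorm//.
congr (_ + _); apply: eq_bigr => i _.
by rewrite rmorphM /= cabs2E ipC// [X in _ * X]mulrC.
Qed.

Lemma reg_formC f g : L2 A f -> L2 A g -> (reg_form f g)^* = reg_form g f.
Proof.
move=> Lf Lg; rewrite /reg_form rmorphD rmorph_sum /= ipC//; congr (_ + _).
apply: eq_bigr => i _; rewrite !rmorphM /= !ipC// [X in _ * X]mulrC.
by congr (_ * _); exact: conjc_real.
Qed.

Lemma reg_formDZr f g g' c : L2 A f -> L2 A g -> L2 A g' ->
  reg_form f (fun x => g x + c * g' x) = reg_form f g + c * reg_form f g'.
Proof.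
move=> Lf Lg Lg'; have Lcg' := L2Z mA c Lg'.
rewrite /reg_form ipDr// ipZr// mulrDr addrACA; congr (_ + _).
rewrite mulr_sumr -big_split; apply: eq_bigr => i _ /=.
by rewrite ipDr// ipZr//; ring.
Qed.

Lemma reg_formDZl f g g' c : L2 A f -> L2 A g -> L2 A g' ->
  reg_form (fun x => f x + c * g x) g' = reg_form f g' + c^* * reg_form g g'.
Proof.
move=> Lf Lg Lg'; rewrite -reg_formC//; last by apply: L2D => //; exact: L2Z.
rewrite reg_formDZr// -(reg_formC Lg' Lf) -(reg_formC Lg' Lg).
by move: (reg_form g' f) (reg_form g' g) => a b; rewrite rmorphD rmorphM.
Qed.

(** The component of [f] that is B-orthogonal to [g] has power B(f, f) - |B(f, g)|^2 / B(g, g),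
    which is nonnegative. *)
Lemma reg_form_Cauchy_Schwarz f g : L2 A f -> L2 A g -> 0 < reg_power g ->
  cabs2 (reg_form f g) <= reg_power f * reg_power g.
Proof.
move=> Lf Lg g_gt0; rewrite -ler_pdivrMr// -subr_ge0.
(* Chosen so that B(g, f + c g) = 0. *)
pose c : R[i] := - reg_form g f / (reg_power g)%:C%C.
have Lcg := L2Z mA c Lg; have Lu := L2D mA Lf Lcg.
suff -> : reg_power f - cabs2 (reg_form f g) / reg_power g =
    reg_power (fun x => f x + c * g x).
  exact: reg_power_ge0.
have g0 : (reg_power g)%:C%C != 0 :> R[i] by rewrite gt_eqF// ltcR.
(* The real identity is checked among complex numbers, where sesquilinearity expands the right-hand
   side. *)
apply: complexI; rewrite -[RHS]reg_formE// reg_formDZl// !reg_formDZr// !reg_formE//.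
have -> : c^* = - reg_form f g / (reg_power g)%:C%C.
  rewrite -(reg_formC Lg Lf) /c; move: (reg_form g f) (reg_power g) => a b.
  by rewrite rmorphM rmorphN fmorphV; congr (_ / _); exact: conjc_real.
rewrite /c -(reg_formC Lf Lg).
move: (reg_form f g) (reg_power f) (reg_power g) g0 => a b d d0.
by rewrite rmorphB rmorphM fmorphV /= cabs2E; field.
Qed.

Section Representer.
Context (w0 : R3 R -> R[i]).
Hypothesis Lw0 : L2 A w0.
Hypothesis w0_repr : forall f, L2 A f -> reg_form f w0 = ip A f (h k).

Lemma ip_representer : ip A w0 (h k) = (reg_power w0)%:C%C.
Proof. by rewrite -w0_repr// reg_formE. Qed.

Lemma sinr_representer_max w : 0 < reg_power w0 -> 0 < reg_power w -> L2 A w ->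
  p k * cabs2 (ip A w (h k)) / reg_power w <=
  p k * cabs2 (ip A w0 (h k)) / reg_power w0.
Proof.
move=> w00 w_gt0 Lw; rewrite ip_representer -w0_repr// -!mulrA.
apply: ler_wpM2l; first exact: p_ge0.
(* As <w0, h_k> is the real number B(w0, w0), the right-hand ratio collapses to B(w0, w0). *)
rewrite [in leRHS]/cabs2 /= expr0n addr0 expr2 mulfK ?gt_eqF//.
by rewrite ler_pdivrMr// mulrC reg_form_Cauchy_Schwarz.
Qed.
End Representer.
End RegularizedForm.

(** * Invertibility of a positive diagonal plus a Gram matrix *)

Section RegularizedGram.
Context (R : realType) (A : set (R3 R)) (n : nat) (g : 'I_n -> R3 R -> R[i]).
Hypothesis mA : measurable (A : set (leb3_space R)).
Hypothesis Lg : forall i, L2 A (g i).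

(** For a nonzero left kernel vector [v], multiplying by its conjugate transpose would make sum d_i
    |v_i|^2 plus a squared norm vanish, but the first sum is positive. *)
Lemma diagD_gram_unitmx (d : 'I_n -> R) : (forall i, 0 < d i) ->
  diag_mx (\row_i (d i)%:C%C) + gram A g \in unitmx.
Proof.
move=> d_gt0; rewrite unitmxE unitfE; apply/negP => /det0P[v v0 vM].
(* [u] is the conjugate transpose of [v]; rewriting [v] through [u] gives the shape of
   [gram_quad]. *)
pose u : 'cV[R[i]]_n := (map_mx (fun z => z^*) v)^T.
have vE : v = (map_mx (fun z => z^*) u)^T.
  by apply/matrixP => i j; rewrite !mxE conjCK.
have := congr1 (fun B : 'rV_n => (B *m u) 0 0) vM.
rewrite mul0mx [RHS]mxE mulmxDr mulmxDl mxE {2}vE (gram_quad mA Lg) => /eqP.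
rewrite gt_eqF//; apply: ltr_wpDr; first by rewrite lecR sqnorm_ge0.
have -> : (v *m diag_mx (\row_i (d i)%:C%C) *m u) 0 0 =
    \sum_i (d i * cabs2 (v 0 i))%:C%C.
  rewrite mxE; apply: eq_bigr => i _.
  by rewrite mul_mx_diag !mxE rmorphM /= cabs2E; ring.
have [i vi0] := rV0Pn _ v0.
have s0 j : 0 <= (d j * cabs2 (v 0 j))%:C%C :> R[i].
  by rewrite lecR mulr_ge0 ?cabs2_ge0 ?ltW.
rewrite (bigD1 i)//=; apply: ltr_pwDl; last by apply: sumr_ge0 => j _.
by rewrite ltcR mulr_gt0 ?cabs2_gt0.
Qed.

End RegularizedGram.

(** * The MMSE beamformer: its two formulas, norm and optimality *)

Section MMSE.
Context (R : realType) (A : set (R3 R)) (K : nat) (k : 'I_K).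
Context (P : 'I_K -> R) (s2 : R) (h : 'I_K -> R3 R -> R[i]).
Hypothesis mA : measurable (A : set (leb3_space R)).
Hypothesis P_gt0 : forall i, 0 < P i.
Hypothesis s2_gt0 : 0 < s2.
Hypothesis Lh : forall i, L2 A (h i).
Hypothesis pdR : posdef (gram A h).

Let p i := P i / s2.
Let p_gt0 i : 0 < p i. Proof. exact: divr_gt0. Qed.

Let M : 'M[R[i]]_K.-1 :=
  diag_mx (\row_(i < K.-1) (s2 / P (lift k i))%:C%C) + Rk A h k.
Let r : 'cV[R[i]]_K.-1 := \col_(i < K.-1) gram A h (lift k i) k.
Let a : 'cV[R[i]]_K.-1 := invmx M *m r.

Lemma Rk_gram : Rk A h k = gram A (fun j => h (lift k j)).
Proof. by apply/matrixP => i j; rewrite !mxE. Qed.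

Lemma MMSE_unitmx : M \in unitmx.
Proof.
rewrite /M Rk_gram; apply: (diagD_gram_unitmx mA) => i //; exact: divr_gt0.
Qed.

Let D : 'M[R[i]]_K.-1 :=
  diag_mx (\row_(i < K.-1) (Num.sqrt (p (lift k i)))%:C%C).

Lemma sqrt_power_unitmx : D \in unitmx.
Proof.
rewrite unitmxE det_diag unitfE prodf_seq_neq0; apply/allP => i _ /=.
by rewrite mxE gt_eqF// ltcR sqrtr_gt0.
Qed.

Lemma Ck_factor : 1%:M + Ck A P s2 h k = D *m M *m D.
Proof.
apply/matrixP => i j.
rewrite mul_mx_diag mul_diag_mx !mxE; case: (i =P j) => [<-|_] /=; last first.
  by rewrite !mulr0n !add0r.
(* On the diagonal, sqrt(p_i) (s2 / P_i) sqrt(p_i) = 1 supplies the identity matrix. *)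
rewrite !mulr1n mulrDr mulrDl; congr (_ + _).
rewrite -!rmorphM /= mulrAC -expr2 sqr_sqrtr ?(ltW (p_gt0 _))//.
by rewrite /p mulrA divfK ?gt_eqF// divff ?gt_eqF.
Qed.

Lemma Cbar_factor : D *m Cbar A P s2 h k *m D = invmx M.
Proof.
have uM := MMSE_unitmx; have uD := sqrt_power_unitmx.
(* Cancelling [M] and then [D] on the left leaves (D M D) (D M D)^-1 D = D. *)
rewrite /Cbar Ck_factor -[LHS](mulKmx uM) -[RHS]mulmx1; congr (_ *m _).
rewrite -[LHS](mulKmx uD) (_ : D *m (M *m _) = D) ?mulVmx//.
by rewrite !mulmxA mulmxV ?mul1mx// !unitmx_mul uD uM.
Qed.

(** Common normal form: [wMMSEE] brings the entrywise formula to the same expression. *)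
Lemma wMMSE_mxE x : wMMSE_mx A P s2 h k x =
  h k x - lincomb (fun j => h (lift k j)) (fun j => a j 0) x.
Proof.
rewrite /wMMSE_mx -mulmxA mxE; congr (_ - _); apply: eq_bigr => j _.
by rewrite mxE mulrC.
Qed.

Lemma wMMSEE x : wMMSE A P s2 h k x =
  h k x - lincomb (fun j => h (lift k j)) (fun j => a j 0) x.
Proof.
rewrite /wMMSE /a -Cbar_factor; congr (_ - _); apply: eq_bigr => i _.
rewrite mxE mulr_suml; apply: eq_bigr => j _.
rewrite mul_mx_diag mul_diag_mx !mxE.
have -> : Num.sqrt (P (lift k i) * P (lift k j)) / s2 =
    Num.sqrt (p (lift k i)) * Num.sqrt (p (lift k j)).
  rewrite /p -sqrtrM ?(ltW (p_gt0 _))// mulrACA -expr2.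
  rewrite [RHS]sqrtrM ?mulr_ge0 ?(ltW (P_gt0 _))//.
  by rewrite sqrtr_sqr ger0_norm // invr_ge0 ltW.
by rewrite rmorphM /=; ring.
Qed.

(** Coefficients of the beamformer on all K responses: [unlift] gives [None] exactly at [k], so the
    default 1 is the coefficient of h_k. *)
Let v : 'cV[R[i]]_K := \col_i oapp (fun j => - a j 0) 1 (unlift k i).

Lemma sum_coefs (F : 'I_K -> R[i]) :
  \sum_i v i 0 * F i = F k - \sum_(j < K.-1) a j 0 * F (lift k j).
Proof.
rewrite (bigD1_ord k)//= mxE unlift_none mul1r -sumrN; congr (_ + _).
by apply: eq_bigr => j _; rewrite mxE liftK mulNr.
Qed.

Lemma wMMSE_lincomb : wMMSE A P s2 h k = lincomb h (fun i => v i 0).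
Proof. by apply/funext => x; rewrite wMMSEE /lincomb sum_coefs. Qed.

Lemma L2_wMMSE : L2 A (wMMSE A P s2 h k).
Proof. by rewrite wMMSE_lincomb; exact: L2_lincomb. Qed.

(** The coefficient vector has entry 1 at [k], hence is nonzero, and positive definiteness of the
    Gram matrix applies. *)
Lemma sqnorm_wMMSE_gt0 : 0 < sqnorm A (wMMSE A P s2 h k).
Proof.
rewrite wMMSE_lincomb -ltcR -gram_quad//; apply: pdR.
apply/eqP => /matrixP/(_ k 0); rewrite !mxE unlift_none.
by apply/eqP; rewrite oner_eq0.
Qed.

Lemma ip_wMMSE f : L2 A f -> ip A f (wMMSE A P s2 h k) =
  ip A f (h k) - \sum_(j < K.-1) a j 0 * ip A f (h (lift k j)).
Proof. by move=> Lf; rewrite wMMSE_lincomb ip_lincomb// sum_coefs. Qed.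

(* These are the normal equations [(P_k^-1 + R_k) a = r_{k,k}]. *)
Lemma power_ip_wMMSE j :
  (p (lift k j))%:C%C * ip A (h (lift k j)) (wMMSE A P s2 h k) = a j 0.
Proof.
have rE : ip A (h (lift k j)) (h k) = (s2 / P (lift k j))%:C%C * a j 0 +
    \sum_(i < K.-1) a i 0 * ip A (h (lift k j)) (h (lift k i)).
  have /matrixP/(_ j 0) := mulKVmx MMSE_unitmx r.
  rewrite -/a /M mulmxDl mul_diag_mx !mxE => <-; congr (_ + _).
  by apply: eq_bigr => i _; rewrite !mxE mulrC.
rewrite ip_wMMSE// rE addrK mulrA -rmorphM /= /p.
by rewrite mulrA divfK ?gt_eqF// divff ?gt_eqF// mul1r.
Qed.

(** The normal equations turn each interference term into a_j <f, h_j>, which cancels the sum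
    subtracted in <f, w_MMSE>. *)
Lemma reg_form_wMMSE f : L2 A f ->
  reg_form A k p h f (wMMSE A P s2 h k) = ip A f (h k).
Proof.
move=> Lf; rewrite /reg_form sum_lift ip_wMMSE// addrC.
under [X in _ + X]eq_bigr do rewrite mulrCA power_ip_wMMSE mulrC.
by rewrite subrK.
Qed.

Lemma sinr_le_wMMSE w : L2 A w -> 0 < sqnorm A w ->
  sinr A P s2 h k w <= sinr A P s2 h k (wMMSE A P s2 h k).
Proof.
have p_ge0 i : 0 <= p i by exact: ltW.
have reg_power_gt0 f : 0 < sqnorm A f -> 0 < reg_power A k p h f.
  move=> f_gt0; apply: ltr_wpDl => //; apply: sumr_ge0 => i _.
  by apply: mulr_ge0 (p_ge0 i) (cabs2_ge0 _).
move=> Lw w_gt0.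
(* With p_i = P_i / s2, [sinr] unfolds to the ratio bounded there, its denominator being
   [reg_power]. *)
apply: (sinr_representer_max mA p_ge0 Lh L2_wMMSE reg_form_wMMSE) => //.
  exact: reg_power_gt0 sqnorm_wMMSE_gt0.
exact: reg_power_gt0.
Qed.

(** Keeps the argument 1 + gamma of the logarithm positive, where [ln] is monotone. *)
Lemma sinr_ge0 w : 0 <= sinr A P s2 h k w.
Proof.
have p_ge0 i : 0 <= p i by exact: ltW.
apply: divr_ge0; first exact: mulr_ge0 (p_ge0 k) (cabs2_ge0 _).
exact: reg_power_ge0.
Qed.

Lemma rate_le w w' : sinr A P s2 h k w <= sinr A P s2 h k w' ->
  rate A P s2 h k w <= rate A P s2 h k w'.
Proof.
move=> sww'; rewrite /rate ler_pM2r; last by rewrite invr_gt0 ln_gt0 ?ltr1n.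
by rewrite ler_ln ?lerD2l// posrE ltr_pwDl// sinr_ge0.
Qed.
End MMSE.

Unset Implicit Arguments.

(** Elements of L^2(A) are classes modulo null sets, so a nonzero one is given by a representative
    of positive squared norm. The second and third conclusions make the beamformer admissible, so
    the bound is attained. *)
Theorem theorem3 (R : realType) (A : set (R3 R)) (K : nat) (P : 'I_K -> R)
    (s2 : R) (h : 'I_K -> R3 R -> R[i]) (k : 'I_K) :
  measurable A ->
  (2 <= K)%N ->
  (forall i, 0 < P i) ->
  0 < s2 ->
  (forall i, L2 A (h i)) ->
  posdef (gram A h) ->
  [/\ (forall x, wMMSE A P s2 h k x = wMMSE_mx A P s2 h k x),
      L2 A (wMMSE A P s2 h k),
      0 < sqnorm A (wMMSE A P s2 h k) &
      forall w : R3 R -> R[i], L2 A w -> 0 < sqnorm A w ->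
        sinr A P s2 h k w <= sinr A P s2 h k (wMMSE A P s2 h k) /\
        rate A P s2 h k w <= rate A P s2 h k (wMMSE A P s2 h k)].
Proof.
move=> mA _ P_gt0 s2_gt0 Lh pdR; split.
- by move=> x; rewrite (wMMSEE k mA) // wMMSE_mxE.
- exact: L2_wMMSE.
- exact: sqnorm_wMMSE_gt0.
- move=> w Lw w_gt0.
  have le_sinr := sinr_le_wMMSE k mA P_gt0 s2_gt0 Lh pdR Lw w_gt0.
  by split=> //; exact: rate_le.
Qed.
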